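(* For all integers $d\ge 1$ and $n\ge 1$, the directed metric dimension of $\vec{\mathcal B}(d,n)$ is $d^{n-1}(d-1)$.
   Context: $\mathcal A_d=\{0,1,\dots,d-1\}$. The directed de Bruijn graph $\vec{\mathcal B}(d,n)$ has vertex set $\mathcal A_d^n$ (strings of length $n$ over $\mathcal A_d$) and an arc from $x_1\cdots x_n$ to $y_1\cdots y_n$ iff $x_2\cdots x_n=y_1\cdots y_{n-1}$. $\vec d(u,v)$ is the length of a shortest directed walk from $u$ to $v$ ($\vec d(v,v)=0$). A directed resolving set is a set $S$ of vertices such that for all distinct vertices $u,v$ there is $s\in S$ with $\vec d(s,u)\ne\vec d(s,v)$. The directed metric dimension is the minimum size of a directed resolving set. *)

(* Defs.v *)
From mathcomp Require Import all_boot.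

Set Implicit Arguments.
Unset Strict Implicit.
Unset Printing Implicit Defensive.

Section DirectedMetricDimension.

Variables (T : finType) (e : rel T).

Definition walk (u v : T) (k : nat) : bool :=
  [exists p : k.-tuple T, path e u p && (last u p == v)].

Lemma connect_walk u v : connect e u v -> exists k, walk u v k.
Proof.
by case/connectP=> p ep ->; exists (size p); apply/existsP; exists (in_tuple p);
  rewrite ep eqxx.
Qed.

(* None stands for infinite distance. *)
Definition ddist (u v : T) : option nat :=
  match @idP (connect e u v) with
  | ReflectT uv => Some (ex_minn (connect_walk uv))
  | ReflectF _ => None
  end.

Lemma ddistP u v k :
  ddist u v = Some k <-> walk u v k /\ forall m, walk u v m -> k <= m.
Proof.
have conn m : walk u v m -> connect e u v.
  by case/existsP=> p /andP[ep /eqP <-]; apply/connectP; exists p.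
rewrite /ddist; case: {-}_ / idP => [uv|nuv]; last first.
  by split=> // -[/conn].
case: ex_minnP => m wm minm; split=> [[<-] //|[wk mink]].
by congr Some; apply/eqP; rewrite eqn_leq minm // mink.
Qed.

Definition directed_resolving (S : {set T}) : bool :=
  [forall u, forall v, (u != v) ==> [exists s in S, ddist s u != ddist s v]].

(* The full vertex set is always resolving (see [directed_resolving_setT]),
   so this is a genuine minimum. *)
Definition directed_metric_dim : nat :=
  #|[arg min_(S < [set: T] | directed_resolving S) #|S| ]|.

Lemma directed_resolving_setT : directed_resolving [set: T].
Proof.
apply/forallP=> u; apply/forallP=> v; apply/implyP=> neq_uv.
apply/existsP; exists u; rewrite inE /=; apply/eqP.
have -> : ddist u u = Some 0.
  by apply/ddistP; split=> //; apply/existsP; exists [tuple]; rewrite /= eqxx.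
move/esym/ddistP=> [/existsP[p /andP[_ last_p]] _].
by move: last_p; rewrite (tuple0 p) /= (negPf neq_uv).
Qed.

End DirectedMetricDimension.

Definition de_bruijn (d n : nat) : rel (n.-tuple 'I_d) :=
  fun x y => behead x == take n.-1 y.

(* Main.v *)
Require Import Defs.
From mathcomp Require Import all_boot.

Set Implicit Arguments.
Unset Strict Implicit.
Unset Printing Implicit Defensive.

(** A walk of length [k <= n] from [s] to [u] exists iff the suffix of [s] of
    length [n - k] is the prefix of [u] of that length.  Two vertices that
    differ only in their last letter have the same in-neighbours, so they can
    only be resolved by one of the two: a resolving set misses at most one
    vertex for each of the [d ^ (n - 1)] prefixes of length [n - 1].
    Conversely, the vertices with nonzero last letter are resolving: if [u] and
    [v] differ in position [i], where, say, [u_i != 0], then any vertex [s] with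
    suffix [u_0 ... u_i] resolves them, since equal distances would force
    [u] and [v] to share a prefix of length greater than [i]. *)

Section Distance.

Variables (T : finType) (e : rel T).
Implicit Types u v s : T.

Lemma walk0 u v : walk e u v 0 = (u == v).
Proof.
apply/existsP/idP => [[p]|uv]; first by rewrite (tuple0 p).
by exists [tuple].
Qed.

Lemma walkS u v k : walk e u v k.+1 <-> exists2 w, e u w & walk e w v k.
Proof.
split=> [/existsP[p]|[w uw /existsP[p pP]]].
  case/tupleP: p => w p /= /andP[/andP[uw pp] lp].
  by exists w => //; apply/existsP; exists p; rewrite pp.
by apply/existsP; exists [tuple of w :: p]; rewrite /= uw.
Qed.

Lemma walk1 u v : walk e u v 1 = e u v.
Proof.
apply/idP/idP=> [/walkS[w uw]|uv]; first by rewrite walk0 => /eqP <-.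
by apply/walkS; exists v; rewrite ?walk0.
Qed.

Lemma walk_ddist u v k : walk e u v k ->
  exists m, [/\ ddist e u v = Some m, walk e u v m & m <= k].
Proof.
move=> wk; case: (@ex_minnP (walk e u v) (ex_intro _ k wk)) => m wm minm.
by exists m; split; [apply/ddistP|exact: wm|exact: minm].
Qed.

Lemma eq_ddist s u v : walk e s u =1 walk e s v -> ddist e s u = ddist e s v.
Proof.
move=> E; case Du: (ddist e s u) => [m|].
  by case/ddistP: Du => wm minm; apply/esym/ddistP; rewrite -E;
    split=> // k; rewrite -E; exact: minm.
case Dv: (ddist e s v) => [m|//].
case/ddistP: Dv => wm _; move: wm; rewrite -E => /walk_ddist[k [Dk _ _]].
by rewrite Dk in Du.
Qed.

(** A walk of positive length sees its endpoint only through its last arc; the assumptions on [s]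
    settle length 0. *)
Lemma walk_eq_in_neighbours s u v : s != u -> s != v -> e^~ u =1 e^~ v ->
  walk e s u =1 walk e s v.
Proof.
move=> su sv E k.
case: k => [|k]; first by rewrite !walk0 (negPf su) (negPf sv).
(* The induction starts at length 1 and forgets [su] and [sv], as intermediate vertices may equal
   [u] or [v]. *)
elim: k s {su sv} => [|k IH] s; first by rewrite !walk1; exact: E.
by apply/idP/idP=> /walkS[w ew ww]; apply/walkS; exists w; rewrite // ?IH // -IH.
Qed.

Lemma directed_resolving_eq_in_neighbours (S : {set T}) u v :
    directed_resolving e S -> e^~ u =1 e^~ v -> u \notin S -> v \notin S ->
  u = v.
Proof.
move=> /forallP/(_ u)/forallP/(_ v)/implyP resS E uS vS.
apply/eqP/negPn/negP => /resS/existsP[s /andP[sS /eqP[]]].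
by apply/eq_ddist/walk_eq_in_neighbours => //; apply: contraTneq sS => ->.
Qed.

Lemma directed_metric_dimP k :
    (exists2 S : {set T}, directed_resolving e S & #|S| <= k) ->
    (forall S : {set T}, directed_resolving e S -> k <= #|S|) ->
  directed_metric_dim e = k.
Proof.
move=> [S resS cardS] minS; rewrite /directed_metric_dim.
case: arg_minnP => [|A resA minA]; first exact: directed_resolving_setT.
by apply/eqP; rewrite eqn_leq minS // (leq_trans (minA S resS)).
Qed.

End Distance.

Section DeBruijn.

Variables d m : nat.
Notation V := (m.+1.-tuple 'I_d.+1).
Notation e := (@de_bruijn d.+1 m.+1).
Implicit Types s u v : V.

Lemma de_bruijn_walk_drop s u k : walk e s u k -> drop k s = take (m.+1 - k) u.
Proof.
elim: k s => [|k IH] s.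
  by rewrite walk0 => /eqP ->; rewrite drop0 subn0 take_oversize ?size_tuple.
case/walkS=> w /eqP /= sw /IH kw.
have -> : drop k.+1 s = drop k (behead s) by rewrite -drop1 drop_drop addn1.
rewrite sw.
(* For [m < k] every letter of [s] has been shifted out, and truncated subtraction makes both sides
   empty. *)
have [km|mk] := leqP k m; last first.
  rewrite drop_oversize ?size_take_min ?size_tuple ?geq_min ?(ltnW mk) //.
  by rewrite (eqP (_ : m.+1 - k.+1 == 0)) ?take0 // subSS subn_eq0 ltnW.
have -> : drop k (take m w) = take (m - k) (drop k w).
  by rewrite take_drop subnK.
by rewrite kw take_takel ?subSS ?leq_sub2r.
Qed.

Lemma drop_de_bruijn_walk s u k : k <= m.+1 -> drop k s = take (m.+1 - k) u ->
  walk e s u k.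
Proof.
elim: k s => [|k IH] s.
  move=> _; rewrite drop0 subn0 take_oversize ?size_tuple // walk0.
  by move=> su; apply/eqP/val_inj.
move=> km sE; apply/walkS.
have su : m - k < size u by rewrite size_tuple ltnS leq_subr.
(* The suffix [drop k.+1 s] already spells the first [m - k] letters of [u], so the letter to append
   is the next one. *)
pose w := [tuple of rcons (behead_tuple s) (nth ord0 u (m - k))] : V.
exists w; first by rewrite /de_bruijn /= -cats1 take_cat size_behead size_tuple
  /= ltnn subnn take0 cats0.
apply: IH; first exact: ltnW.
rewrite /= drop_rcons ?size_behead ?size_tuple // -drop1 drop_drop addn1 sE.
by rewrite -take_nth // subSS subSn.
Qed.

Lemma ddist_neq_prefix s u v (i : 'I_m.+1) : tnth u i != tnth v i ->
  drop (m - i) s = take i.+1 u -> ddist e s u != ddist e s v.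
Proof.
move=> uv sE; have im : i <= m by rewrite -ltnS.
have /drop_de_bruijn_walk : m - i <= m.+1 by rewrite leqW ?leq_subr.
move=> /(_ s u); rewrite subSn ?leq_subr // subKn // => /(_ sE).
case/walk_ddist=> k [Du wu ki]; apply/eqP; rewrite Du => /esym/ddistP[wv _].
(* Position [i] thus lies in the prefix of length [m.+1 - k] that [u] and [v] would share. *)
have ik : i < m.+1 - k by rewrite ltn_subRL ltnS addnC -leq_subRL.
case/eqP: uv; rewrite !(tnth_nth ord0) -(nth_take _ ik) -(nth_take _ ik v).
by rewrite -(de_bruijn_walk_drop wu) (de_bruijn_walk_drop wv).
Qed.

Definition nonzero_last : {set V} := [set s : V | tnth s ord_max != ord0].

(** Padding [take i.+1 u] with zeros on the left gives a vertex whose last letter is that of [u] at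
    [i]. *)
Lemma exists_nonzero_last_suffix u (i : 'I_m.+1) : tnth u i != ord0 ->
  exists2 s, s \in nonzero_last & drop (m - i) s = take i.+1 u.
Proof.
move=> ui; have im : i <= m by rewrite -ltnS.
have ssz : size (nseq (m - i) ord0 ++ take i.+1 u) == m.+1.
  by rewrite size_cat size_nseq size_takel ?size_tuple // addnS subnK.
exists (Tuple ssz); last by rewrite /= drop_size_cat // size_nseq.
rewrite inE (tnth_nth ord0) /= nth_cat size_nseq ltnNge leq_subr /=.
by rewrite subKn // nth_take // -tnth_nth.
Qed.

Lemma nonzero_last_resolving : directed_resolving e nonzero_last.
Proof.
apply/forallP=> u; apply/forallP=> v; apply/implyP=> uv.
have [i uvi] : exists i, tnth u i != tnth v i.
  apply/existsP; apply: contraR uv; rewrite negb_exists => /forallP uv.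
  by apply/eqP/eq_from_tnth => i; apply/eqP/negPn/uv.
apply/existsP; have [u0|/exists_nonzero_last_suffix[s sS sE]] :=
  eqVneq (tnth u i) ord0.
  (* The letter of [v] at [i] differs from 0, so [u] and [v] exchange roles. *)
  have /exists_nonzero_last_suffix[s sS sE] : tnth v i != ord0.
    by rewrite -u0 eq_sym.
  by exists s; rewrite sS eq_sym; apply: ddist_neq_prefix sE; rewrite eq_sym.
by exists s; rewrite sS; apply: ddist_neq_prefix sE.
Qed.

Lemma card_nonzero_last : #|nonzero_last| <= d.+1 ^ m * d.
Proof.
suff: d.+1 ^ m <= #|~: nonzero_last|.
  rewrite -(leq_add2l #|nonzero_last|) cardsC card_tuple card_ord expnS mulSn.
  by rewrite addnC mulnC leq_add2l.
(* Appending 0 embeds the words of length [m] into the complement. *)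
pose f (t : m.-tuple 'I_d.+1) : V := [tuple of rcons t ord0].
have finj : injective f.
  by move=> x y /(congr1 val) /= /rcons_inj[] /val_inj.
rewrite -[d.+1 in X in X <= _]card_ord -card_tuple -(card_imset predT finj).
apply/subset_leq_card/subsetP=> _ /imsetP[t _ ->].
by rewrite !inE negbK (tnth_nth ord0) /= nth_rcons size_tuple ltnn eqxx.
Qed.

Lemma directed_resolving_card (S : {set V}) :
  directed_resolving e S -> d.+1 ^ m * d <= #|S|.
Proof.
move=> resS; suff: #|~: S| <= d.+1 ^ m.
  rewrite -(leq_add2l #|S|) cardsC card_tuple card_ord expnS mulSn.
  by rewrite [#|S| + _]addnC mulnC leq_add2l.
have prefix_size u : size (take m u) == m by rewrite size_takel ?size_tuple.
pose f u : m.-tuple 'I_d.+1 := Tuple (prefix_size u).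
have finj : {in ~: S &, injective f}.
  move=> u v; rewrite !inE => uS vS /(congr1 val) /= uv.
  (* An arc into a vertex constrains only its first [m] letters, so equal prefixes give equal
     in-neighbours. *)
  apply: directed_resolving_eq_in_neighbours resS _ uS vS => s.
  by rewrite /de_bruijn /= uv.
by rewrite -(card_in_imset finj) (leq_trans (max_card _)) // card_tuple card_ord.
Qed.

End DeBruijn.

Theorem theorem4p6 (d n : nat) (hd : 1 <= d) (hn : 1 <= n) :
  directed_metric_dim (@de_bruijn d n) = d ^ (n - 1) * (d - 1).
Proof.
(* Writing both parameters as successors provides the letter [ord0] and removes the subtractions. *)
case: d n hd hn => // d [//|m] _ _; rewrite !subSS !subn0.
apply: directed_metric_dimP; last exact: directed_resolving_card.
by exists (nonzero_last d m);
  [exact: nonzero_last_resolving | exact: card_nonzero_last].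
Qed.
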